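(* Let $J=\{1,\dots,n\}$, let $x_j\in\mathbb{R}^m$, $y_j\in\mathbb{R}^s$ ($j\in J$) be vectors with strictly positive components, and let $DMU_o=(x_o,y_o)$, $o\in J$, be $FDH_V$-efficient. Define, for $j\in J$, $$\alpha_{jo}:=\max_{1\le i\le m}\frac{x_{ij}}{x_{io}},\qquad \beta_{jo}:=\min_{1\le r\le s}\frac{y_{rj}}{y_{ro}}.$$ Then: (i) Right-IRS prevails at $DMU_o$ if and only if there exists some $j\in J$ such that $\beta_{jo}>1$ and $\alpha_{jo}<\beta_{jo}$. (ii) Right-DRS prevails at $DMU_o$ if and only if for each $j\in J$, $\beta_{jo}\le1$ or $\beta_{jo}<\alpha_{jo}$. (iii) Right-CRS prevails at $DMU_o$ if and only if both of the following hold: (iii-a) for each $j\in J$, $\alpha_{jo}\ge\beta_{jo}$ or $\beta_{jo}\le1$; (iii-b) for some $j\in J$, $\beta_{jo}>1$ and $\beta_{jo}\ge\alpha_{jo}$.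
   Context: There are $n$ decision making units $DMU_j=(x_j,y_j)$, $j\in J$, with strictly positive input vectors $x_j=(x_{1j},\dots,x_{mj})^t$ and output vectors $y_j=(y_{1j},\dots,y_{sj})^t$. Vector inequalities are componentwise. The technology is $$T^{FDH_V}=\Big\{(x,y)\in\mathbb{R}^m\times\mathbb{R}^s:\ \exists\,\lambda\in\{0,1\}^n,\ \sum_{j}\lambda_j=1,\ \sum_j\lambda_jx_j\le x,\ \sum_j\lambda_jy_j\ge y\ge0\Big\}.$$ $DMU_o$ is $FDH_V$-efficient if there is no $(x,y)\in T^{FDH_V}$ with $x\le x_o$, $y\ge y_o$, $(x,y)\neq(x_o,y_o)$. $\operatorname{int}A$ and $A^c$ denote the interior and the complement of a set $A$ (in $\mathbb{R}^{m+s}$), and $z_\delta:=(\delta x_o,\delta y_o)$. One-sided returns to scale on the right, for an $FDH_V$-efficient $DMU_o$: Right-IRS prevails if $z_\delta\in\operatorname{int}T^{FDH_V}$ for some $\delta>1$; Right-DRS prevails if $z_\delta\in(T^{FDH_V})^c$ for each $\delta>1$; Right-CRS prevails if neither Right-IRS nor Right-DRS prevails. *)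

(* Defs.v *)
From HB Require Import structures.
From mathcomp Require Import all_boot all_order all_algebra.
From mathcomp Require Import all_classical all_reals all_analysis.

Set Implicit Arguments.
Unset Strict Implicit.
Unset Printing Implicit Defensive.

Import Order.TTheory GRing.Theory Num.Theory.
Import numFieldNormedType.Exports.

Local Open Scope classical_set_scope.
Local Open Scope ring_scope.

(* There are [m.+1] inputs and [s.+1] outputs, so that the max and min below
   range over nonempty index sets. R^(m+s) is rendered as the product of the
   input and output spaces, with its product topology. *)

Definition vle (R : realType) (k : nat) (u v : 'cV[R]_k) : Prop :=
  forall i : 'I_k, u i 0 <= v i 0.

Section FDH.
Variables (R : realType) (n m s : nat).
Variables (x : 'I_n -> 'cV[R]_m.+1) (y : 'I_n -> 'cV[R]_s.+1).

Definition FDHV : set ('cV[R]_m.+1 * 'cV[R]_s.+1) :=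
  [set p | exists lambda : 'I_n -> R,
    [/\ forall j, lambda j = 0 \/ lambda j = 1,
        \sum_j lambda j = 1,
        vle (\sum_j lambda j *: x j) p.1,
        vle p.2 (\sum_j lambda j *: y j) &
        vle 0 p.2]].

Definition FDHV_efficient (o : 'I_n) : Prop :=
  ~ exists p : 'cV[R]_m.+1 * 'cV[R]_s.+1,
      [/\ FDHV p, vle p.1 (x o), vle (y o) p.2 & p <> (x o, y o)].

Definition zray (o : 'I_n) (delta : R) : 'cV[R]_m.+1 * 'cV[R]_s.+1 :=
  (delta *: x o, delta *: y o).

Definition right_IRS (o : 'I_n) : Prop :=
  exists2 delta : R, 1 < delta & interior FDHV (zray o delta).

Definition right_DRS (o : 'I_n) : Prop :=
  forall delta : R, 1 < delta -> (~` FDHV) (zray o delta).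

Definition right_CRS (o : 'I_n) : Prop := ~ right_IRS o /\ ~ right_DRS o.

(* The default value of each iterated max/min is its own first term. *)
Definition alpha (j o : 'I_n) : R :=
  \big[Num.max/x j ord0 0 / x o ord0 0]_(i < m.+1) (x j i 0 / x o i 0).

Definition beta (j o : 'I_n) : R :=
  \big[Num.min/y j ord0 0 / y o ord0 0]_(r < s.+1) (y j r 0 / y o r 0).

End FDH.

(* Main.v *)
Require Import Defs.
From mathcomp Require Import all_boot all_order all_algebra.
From mathcomp Require Import all_classical all_reals all_analysis.
From mathcomp Require Import lra.

Import Order.TTheory GRing.Theory Num.Theory.
Import numFieldNormedType.Exports.
Local Open Scope ring_scope.

(** A 0/1 vector of sum 1 selects a single unit, so the technology is the
    finite union of the free-disposal sets
      P_j = { (u, v) | x_j <= u, 0 <= v <= y_j }   ([FDHVP]).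
    Since alpha_jo is the least t with x_j <= t x_o and beta_jo the greatest t
    with t y_o <= y_j, the set P_j meets the ray through DMU_o exactly in the
    parameters delta of [alpha_jo, beta_jo] ([FDHV_scaleP]), and the interior
    of the technology meets it in the union of the corresponding open intervals
    ([interior_FDHV_zrayP]).  Increasing returns say that one of the open
    intervals contains some delta > 1, which happens iff beta_jo > 1 and
    alpha_jo < beta_jo: take delta between max(1, alpha_jo) and beta_jo.
    Decreasing returns say that no closed interval contains such a delta; the
    j-th one does iff beta_jo > 1 and alpha_jo <= beta_jo: take
    delta = beta_jo.  Constant returns negate both.

    The union of the open intervals could a priori be smaller than what the
    interior cuts out: a ray point could lie on the boundary of several P_j
    which together surround it.  This does not happen, because around an
    interior point all inputs can be decreased and all outputs increased at
    once, and any P_j containing the improved point has the original one in its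
    own interior. *)

Lemma bool_sum1_select (R : realType) (n : nat) (lambda : 'I_n -> R) :
  (forall j, lambda j = 0 \/ lambda j = 1) -> \sum_j lambda j = 1 ->
  exists k, forall j, lambda j = (j == k)%:R.
Proof.
move=> l01 sum1.
have l_ge0 j : 0 <= lambda j by case: (l01 j) => ->.
have [k lk] : exists k, lambda k = 1.
  apply: contrapT => no1; suff : \sum_j lambda j = 0.
    by rewrite sum1 => /eqP; rewrite oner_eq0.
  by apply: big1 => j _; case: (l01 j) => // lj; case: no1; exists j.
exists k => j; have [->//|jk] := eqVneq j k.
have rest0 : \sum_(i | i != k) lambda i = 0.
  by move: sum1; rewrite (bigD1 k) //= lk => h; lra.
by rewrite (psumr_eq0P _ rest0).
Qed.

Section Technology.
Local Open Scope classical_set_scope.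
Local Open Scope ring_scope.
Variables (R : realType) (n m s : nat).
Variables (x : 'I_n -> 'cV[R]_m.+1) (y : 'I_n -> 'cV[R]_s.+1).

Lemma sum_delta_scale (k : nat) (v : 'I_n -> 'cV[R]_k) (i : 'I_n) :
  \sum_j (j == i)%:R *: v j = v i.
Proof.
rewrite (bigD1 i) //= eqxx scale1r big1 ?addr0 // => j /negPf ->.
by rewrite scale0r.
Qed.

Lemma FDHVP (p : 'cV[R]_m.+1 * 'cV[R]_s.+1) :
  FDHV x y p <-> exists j, [/\ vle (x j) p.1, vle p.2 (y j) & vle 0 p.2].
Proof.
split=> [[lambda [l01 sum1 lex ley p_ge0]]|[k [lex ley p_ge0]]].
  have [k lE] := bool_sum1_select R n lambda l01 sum1; exists k.
  have sumE d (v : 'I_n -> 'cV[R]_d) : \sum_j lambda j *: v j = v k.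
    by under eq_bigr do rewrite lE; exact: sum_delta_scale.
  by move: lex ley; rewrite !sumE.
exists (fun j => (j == k)%:R); rewrite !sum_delta_scale; split=> //.
  by move=> j; case: (j == k); [right|left].
by rewrite (bigD1 k) //= eqxx big1 ?addr0 // => j /negPf ->.
Qed.

Hypothesis x_gt0 : forall j i, 0 < x j i 0.
Hypothesis y_gt0 : forall j r, 0 < y j r 0.
Variable o : 'I_n.

Lemma alpha_leP (j : 'I_n) (t : R) :
  alpha x j o <= t <-> forall i, x j i 0 <= t * x o i 0.
Proof.
split=> [/bigmax_leP[_ h] i|h]; first by rewrite -ler_pdivrMr // h.
by apply/bigmax_leP; split=> [|i _]; rewrite ler_pdivrMr.
Qed.

Lemma le_betaP (j : 'I_n) (t : R) :
  t <= beta y j o <-> forall r, t * y o r 0 <= y j r 0.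
Proof.
split=> [/bigmin_geP[_ h] r|h]; first by rewrite -ler_pdivlMr // h.
by apply/bigmin_geP; split=> [|i _]; rewrite ler_pdivlMr.
Qed.

Lemma alpha_ltP (j : 'I_n) (t : R) :
  alpha x j o < t <-> forall i, x j i 0 < t * x o i 0.
Proof.
split=> [/bigmax_ltP[_ h] i|h]; first by rewrite -ltr_pdivrMr // h.
by apply/bigmax_ltP; split=> [|i _]; rewrite ltr_pdivrMr.
Qed.

Lemma lt_betaP (j : 'I_n) (t : R) :
  t < beta y j o <-> forall r, t * y o r 0 < y j r 0.
Proof.
split=> [/bigmin_gtP[_ h] r|h]; first by rewrite -ltr_pdivlMr // h.
by apply/bigmin_gtP; split=> [|i _]; rewrite ltr_pdivlMr.
Qed.

(** Inputs and outputs are scaled by separate factors, because the proof of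
    [interior_FDHV_zrayP] leaves the ray by shrinking the former and expanding
    the latter. *)
Lemma FDHV_scaleP (t u : R) : 0 <= u ->
  FDHV x y (t *: x o, u *: y o) <->
  exists j, alpha x j o <= t /\ u <= beta y j o.
Proof.
move=> u_ge0; rewrite FDHVP; split=> [[j /= [lex ley _]]|[j [aj bj]]]; exists j.
  split; first by apply/alpha_leP => i; move: (lex i); rewrite mxE.
  by apply/le_betaP => r; move: (ley r); rewrite mxE.
split=> i /=; rewrite !mxE.
- by move/alpha_leP: aj.
- by move/le_betaP: bj.
- by rewrite mulr_ge0 // ltW.
Qed.

(** Left to right, e > 0 is small enough for the point with inputs
    (delta - e) x_o and outputs (delta + e) y_o to belong to the technology;
    the unit j dominating that point satisfies alpha_jo <= delta - e and
    delta + e <= beta_jo.  Right to left, the strict inequalities between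
    coordinates persist on a neighbourhood. *)
Lemma interior_FDHV_zrayP (delta : R) : 0 < delta ->
  interior (FDHV x y) (zray x y o delta) <->
  exists j, alpha x j o < delta /\ delta < beta y j o.
Proof.
move=> d_gt0; split=> [intT|[j [aj bj]]].
  pose f (e : R) := ((delta - e) *: x o, (delta + e) *: y o).
  have f_cvg : f e @[e --> 0^'+] --> zray x y o delta.
    apply: cvg_at_right_filter.
    have cvgx : (delta - e) *: x o @[e --> (0 : R)] --> delta *: x o.
      apply: cvgZr_tmp.
      suff : delta - e @[e --> (0 : R)] --> delta - 0 by rewrite subr0.
      by apply: cvgB; [exact: cvg_cst|exact: cvg_id].
    have cvgy : (delta + e) *: y o @[e --> (0 : R)] --> delta *: y o.
      apply: cvgZr_tmp.
      suff : delta + e @[e --> (0 : R)] --> delta + 0 by rewrite addr0.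
      by apply: cvgD; [exact: cvg_cst|exact: cvg_id].
    exact: cvg_pair cvgx cvgy.
  have nearT : \forall e \near 0^'+, FDHV x y (f e).
    exact: f_cvg intT.
  near (0 : R)^'+ => e.
  have e_gt0 : 0 < e by near: e; exact: nbhs_right_gt.
  have [||j [aj bj]] := (FDHV_scaleP (delta - e) (delta + e) _).1.
  - by lra.
  - by near: e.
  - by exists j; split; lra.
have near_x i : \forall p \near zray x y o delta,
    x j i 0 < (p.1 : 'cV[R]_m.+1) i 0.
  have cvgi : (p.1 : 'cV[R]_m.+1) i 0 @[p --> zray x y o delta]
      --> (delta *: x o) i 0.
    apply: (@cvg_comp _ _ _ fst (fun v : 'cV[R]_m.+1 => v i 0)
      (nbhs (zray x y o delta)) (nbhs (delta *: x o))); first exact: cvg_fst.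
    exact: coord_continuous.
  by move/cvgr_gt: cvgi; apply; rewrite mxE; move/alpha_ltP: aj.
have near_y r : \forall p \near zray x y o delta,
    0 < (p.2 : 'cV[R]_s.+1) r 0 < y j r 0.
  have cvgr : (p.2 : 'cV[R]_s.+1) r 0 @[p --> zray x y o delta]
      --> (delta *: y o) r 0.
    apply: (@cvg_comp _ _ _ snd (fun v : 'cV[R]_s.+1 => v r 0)
      (nbhs (zray x y o delta)) (nbhs (delta *: y o))); first exact: cvg_snd.
    exact: coord_continuous.
  near=> p; apply/andP; split; near: p.
    by move/cvgr_gt: cvgr; apply; rewrite mxE mulr_gt0.
  by move/cvgr_lt: cvgr; apply; rewrite mxE; move/lt_betaP: bj.
have nbhsF : Filter (nbhs (zray x y o delta)) by exact: nbhs_filter.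
apply: filterS2 (filter_forall nbhsF near_x) (filter_forall nbhsF near_y).
move=> p x_lt y_lt.
apply/FDHVP; exists j; split=> i; rewrite ?mxE ltW //.
- by have /andP[] := y_lt i.
- by have /andP[] := y_lt i.
Unshelve. all: by end_near.
Qed.

Lemma right_IRS_P : right_IRS x y o <->
  exists j, 1 < beta y j o /\ alpha x j o < beta y j o.
Proof.
split=> [[d d_gt1 /interior_FDHV_zrayP[|j [aj bj]]]|[j [b_gt1 ab]]].
- exact: lt_trans d_gt1.
- by exists j; split; lra.
have : Num.max 1 (alpha x j o) < beta y j o by rewrite gt_max b_gt1.
move=> /midf_lt[]; set d := (_ / _); rewrite gt_max => /andP[d_gt1 ad] db.
exists d => //; apply/interior_FDHV_zrayP; first exact: lt_trans d_gt1.
by exists j.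
Qed.

Lemma right_DRS_P : right_DRS x y o <->
  forall j, beta y j o <= 1 \/ beta y j o < alpha x j o.
Proof.
split=> [drs j|noj d d_gt1 /FDHV_scaleP[|j [aj bj]]]; last 2 first.
- by lra.
- by case: (noj j) => ?; lra.
have [|b_gt1] := leP (beta y j o) 1; [by left|right].
rewrite ltNge; apply/negP => ab; apply: (drs _ b_gt1).
by apply/FDHV_scaleP; [lra|exists j].
Qed.

End Technology.

Theorem theorem4 (R : realType) (n m s : nat)
    (x : 'I_n -> 'cV[R]_m.+1) (y : 'I_n -> 'cV[R]_s.+1) (o : 'I_n)
    (hx : forall (j : 'I_n) (i : 'I_m.+1), 0 < x j i 0)
    (hy : forall (j : 'I_n) (r : 'I_s.+1), 0 < y j r 0)
    (ho : FDHV_efficient x y o) :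
  [/\ right_IRS x y o <->
        (exists j : 'I_n, 1 < beta y j o /\ alpha x j o < beta y j o),
      right_DRS x y o <->
        (forall j : 'I_n, beta y j o <= 1 \/ beta y j o < alpha x j o) &
      right_CRS x y o <->
        (forall j : 'I_n, alpha x j o >= beta y j o \/ beta y j o <= 1) /\
        (exists j : 'I_n, 1 < beta y j o /\ alpha x j o <= beta y j o)].
Proof.
have irsP := right_IRS_P _ _ _ _ _ _ hx hy o.
have drsP := right_DRS_P _ _ _ _ _ _ hx hy o.
split=> //; rewrite /right_CRS irsP drsP; split=> [[noirs nodrs]|[noirs [j [b_gt1 ab]]]].
  split=> [j|].
    have [|b_gt1] := leP (beta y j o) 1; [by right|left].
    by rewrite leNgt; apply/negP => ab; apply: noirs; exists j.
  apply: contrapT => noj; apply: nodrs => j.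
  have [|b_gt1] := leP (beta y j o) 1; [by left|right].
  by rewrite ltNge; apply/negP => ab; apply: noj; exists j.
split=> [[k [bk ak]]|/(_ j)[] ?]; [|lra|lra].
by case: (noirs k) => ?; lra.
Qed.
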